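(* Let $p$ be a prime and let $G$ be a finite $p$-group. Then the set of codegrees of the linear characters of $G$ is $\mathrm{cod}_{\mathrm{lin}}(G) = \{ p^{i} : i= 0, 1, \ldots,\log_{p}(\exp(G/G')) \}$.
   Context: For an irreducible complex character $\chi$ of a finite group $G$, its codegree is $\mathrm{cod}(\chi) = |G:\ker\chi|/\chi(1)$. $\mathrm{cod}_{\mathrm{lin}}(G)$ is the set of codegrees $\mathrm{cod}(\chi)$ where $\chi$ runs over all linear (degree $1$) complex characters of $G$. $G'$ is the commutator subgroup and $\exp$ denotes the exponent. *)

(* Defs.v *)
From HB Require Import structures.
From mathcomp Require Import all_boot all_order all_algebra.
From mathcomp Require Import all_fingroup all_solvable all_field all_character.

Set Implicit Arguments.
Unset Strict Implicit.
Unset Printing Implicit Defensive.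

Import GroupScope GRing.Theory.
Local Open Scope ring_scope.

Section Codegree.

Variables (gT : finGroupType) (G : {group gT}).

(* The quotient is taken in algC, where the character degree 'chi_i 1 lives. *)
Definition codegree (i : Iirr G) : algC := #|G : cfker 'chi_i|%:R / 'chi_i 1%g.

(* A sequence, possibly with repetitions, read as a set through its membership
   predicate. *)
Definition cod_lin : seq algC :=
  [seq codegree i | i <- enum (Iirr G) & 'chi_i \is a linear_char].

End Codegree.

(* Main.v *)
Require Import Defs.
From mathcomp Require Import all_boot all_order all_algebra.
From mathcomp Require Import all_fingroup all_solvable all_field all_character.

Import GroupScope GRing.Theory.
Local Open Scope ring_scope.

(** The codegree of a linear character is its order in the group of linear
    characters, because [G / ker chi] is cyclic.  These orders divide
    [exponent (G / G')].  If [G] is a [p]-group and this exponent [p ^ e.+1] were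
    not attained, the [p ^ e]-th power of every element would lie in the kernel
    of every linear character, hence in [G'].  Powers of a linear character of
    maximal order then realise all smaller powers of [p]. *)

(** The quotient is abelian because [cfker xi] contains G'. It also carries a faithful irreducible
    character, so its center, here the whole quotient, is cyclic. *)
Lemma lin_char_quo_cyclic {gT : finGroupType} {G : {group gT}} {xi : 'CF(G)} :
  xi \is a linear_char -> cyclic (G / cfker xi)%g.
Proof.
move=> lin_xi; have abGbar := sub_der1_abelian (lin_char_der1 lin_xi).
have /irrP[j def_xi]: (xi / cfker xi)%CF \in irr (G / cfker xi).
  by rewrite cfQuo_irr ?cfker_normal // lin_char_irr.
have /irr_faithful_center: cfaithful 'chi_j by rewrite -def_xi cfaithful_quo.
by rewrite (center_idP abGbar).
Qed.

Lemma codegree_lin {gT : finGroupType} {G : {group gT}} (i : Iirr G) :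
  'chi_i \is a linear_char -> codegree i = #['chi_i]%CF%:R.
Proof.
move=> lin_i; rewrite /codegree lin_char1 // divr1 cforder_lin_char //.
(* The order of ['chi_i] is now the exponent of [G / cfker 'chi_i], which for a cyclic group is its
   cardinality. *)
by rewrite exponent_cyclic ?lin_char_quo_cyclic // card_quotient ?cfker_norm.
Qed.

Lemma cforder_lin_dvd_exponent {gT : finGroupType} {G : {group gT}} {xi : 'CF(G)} :
  xi \is a linear_char -> (#[xi]%CF %| exponent (G / G^`(1)))%N.
Proof.
move=> lin_xi; apply/dvdn_cforderP => x Gx.
rewrite -lin_charX // -[RHS](lin_char1 lin_xi).
have Nx: x \in 'N(G^`(1))%g by apply: subsetP Gx; apply: der_norm.
have: (x ^+ exponent (G / G^`(1)))%g \in G^`(1)%g.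
  by rewrite coset_idr ?groupX // morphX //= expg_exponent ?mem_quotient.
by move/(subsetP (lin_char_der1 lin_xi));
  rewrite cfkerEchar ?lin_charW // inE => /andP[_ /eqP].
Qed.

Lemma exponent_abelianization_dvd {gT : finGroupType} {G : {group gT}} (n : nat) :
    (forall i : Iirr G, 'chi_i \is a linear_char -> #['chi_i]%CF %| n)%N ->
  (exponent (G / G^`(1)) %| n)%N.
Proof.
move=> order_n; apply/exponentP => _ /morphimP[x Nx Gx ->].
(* The kernels of the linear characters intersect in G', so membership of [x ^+ n] in G' can be
   tested on each of them. *)
rewrite -morphX //= coset_id // -cap_cfker_lin_irr.
apply/bigcapP => i lin_i; rewrite cfkerEchar ?lin_charW // inE groupX //=.
by rewrite lin_charX // (dvdn_cforderP (order_n i lin_i)) // lin_char1.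
Qed.

Lemma pgroup_lin_char_exponent {gT : finGroupType} {G : {group gT}} (p : nat) :
    prime p -> p.-group G ->
  exists2 i : Iirr G, 'chi_i \is a linear_char
                    & #['chi_i]%CF = exponent (G / G^`(1)).
Proof.
move=> p_pr pG; have p_gt1 := prime_gt1 p_pr.
have: p.-nat (exponent (G / G^`(1))) by rewrite pnat_exponent quotient_pgroup.
(* Exponent 1 is attained by the trivial character; otherwise [p ^ e] is the largest proper divisor
   of the exponent. *)
case/p_natP => -[|e] def_e.
  exists 0; first by rewrite irr0 cfun1_lin_char.
  by apply/eqP; rewrite def_e cforder_irr_eq1.
have [i /andP[lin_i ndv] | all_dv] := pickP [pred i : Iirr G |
    ('chi_i \is a linear_char) && ~~ (#['chi_i]%CF %| p ^ e)%N].
  exists i => //; have := cforder_lin_dvd_exponent lin_i; rewrite def_e.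
  case/(dvdn_pfactor _ _ p_pr) => k le_k def_k; rewrite def_k; congr (p ^ _)%N.
  apply/eqP; rewrite eqn_leq le_k ltnNge; apply: contra ndv => le_ke.
  by rewrite def_k dvdn_exp2l.
have: (exponent (G / G^`(1)) %| p ^ e)%N.
  apply: exponent_abelianization_dvd => i lin_i.
  by have:= all_dv i; rewrite /= lin_i => /negbFE.
by rewrite def_e dvdn_Pexp2l // ltnn.
Qed.

(** Both sides have the same multiples: [xi ^+ (a * n)] is trivial iff [a * b] divides [a * n], that
    is, iff [b] divides [n]. *)
Lemma cforder_exp_divn {gT : finGroupType} {G : {group gT}} (xi : 'CF(G)) (a b : nat) :
  (0 < a)%N -> #[xi]%CF = (a * b)%N -> #[xi ^+ a]%CF = b.
Proof.
move=> a_gt0 ord_xi; apply/eqP; rewrite eqn_dvd.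
have dvE n: (#[xi ^+ a]%CF %| n)%N = (b %| n)%N.
  by rewrite dvdn_cforder -exprM -dvdn_cforder ord_xi dvdn_pmul2l.
by rewrite dvE dvdnn -dvE dvdnn.
Qed.

Theorem corollary2p3 (gT : finGroupType) (G : {group gT}) (p : nat) :
  prime p -> p.-group G ->
  cod_lin G =i
    [seq (p ^ i)%N%:R : algC | i <- iota 0 (trunc_log p (exponent (G / G^`(1)%g)%g)).+1].
Proof.
move=> p_pr pG; have p_gt1 := prime_gt1 p_pr.
have [i0 lin_i0 ord_i0] := pgroup_lin_char_exponent p p_pr pG.
have: p.-nat (exponent (G / G^`(1))) by rewrite pnat_exponent quotient_pgroup.
case/p_natP => e def_e; rewrite def_e trunc_expnK // => c.
apply/mapP/mapP => [[i] | [k]].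
  rewrite mem_filter => /andP[lin_i _] ->; rewrite codegree_lin //.
  have := cforder_lin_dvd_exponent lin_i; rewrite def_e.
  case/(dvdn_pfactor _ _ p_pr) => k le_k ->.
  by exists k; rewrite // mem_iota.
rewrite mem_iota /= add0n ltnS => le_ke ->.
(* As ['chi_i0] has order [p ^ e], its power by [p ^ (e - k)] has order [p ^ k]. *)
have lin_xi: 'chi_i0 ^+ (p ^ (e - k)) \is a linear_char by rewrite rpredX.
have /irrP[j def_j] := lin_char_irr lin_xi.
have lin_j: 'chi_j \is a linear_char by rewrite -def_j.
exists j; first by rewrite mem_filter lin_j mem_enum.
rewrite codegree_lin // -def_j (@cforder_exp_divn _ _ _ _ (p ^ k)) //.
  by rewrite expn_gt0 prime_gt0.
by rewrite ord_i0 def_e -expnD subnK.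
Qed.
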